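(* Let $\tau$ be a finite relational signature. A class $\mathcal{C}\subseteq\mathsf{FIN}(\tau)$ is decided by an adaptive left unbounded query algorithm over $\mathbb{B}$ if and only if $\mathcal{C}$ is clopen (both open and closed) in the topological space $(\mathsf{FIN}(\tau),\mathfrak{T})$.
   Context: $\mathsf{FIN}(\tau)$ is the class of all finite relational structures of signature $\tau$ with non-empty domain (classes are closed under isomorphism). For $A\in\mathsf{FIN}(\tau)$, $\uparrow A=\{B\in\mathsf{FIN}(\tau): A\to B\}$, where $A\to B$ means there is a homomorphism from $A$ to $B$. $\mathfrak{T}$ is the topology on $\mathsf{FIN}(\tau)$ generated by the subbasis $\{\uparrow A: A\in\mathsf{FIN}(\tau)\}\cup\{\mathsf{FIN}(\tau)\setminus\uparrow A: A\in\mathsf{FIN}(\tau)\}$. $\hom_{\mathbb{B}}(F,A)$ is $1$ if $F\to A$ and $0$ otherwise. For a set $\Sigma$, $\Sigma^{<\omega}$ is the set of finite strings over $\Sigma$; a subtree is a prefix-closed subset, a leaf an element with no proper extension. An adaptive left unbounded query algorithm over $\mathbb{B}$ is a function $G:\mathcal{T}\to\mathsf{FIN}(\tau)\cup\{\mathsf{YES},\mathsf{NO}\}$ with $\mathcal{T}\subseteq\{0,1\}^{<\omega}$ a subtree and $G(\sigma)\in\{\mathsf{YES},\mathsf{NO}\}$ iff $\sigma$ is a leaf; its computation path on $A$ is the limit of $\sigma_0=\varepsilon$, $\sigma_{i+1}=\sigma_i$ if $G(\sigma_i)\in\{\mathsf{YES},\mathsf{NO}\}$, else $\sigma_{i+1}=\sigma_i\bullet\hom_{\mathbb{B}}(G(\sigma_i),A)$.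 It is required to be total (finite path on every input) and decides $\{A:G(\text{path of }A)=\mathsf{YES}\}$. *)

(* Defs.v *)
(* MathComp-Analysis, with its classical axioms. *)
From HB Require Import structures.
From mathcomp Require Import all_boot.
From mathcomp Require Import boolp classical_sets cardinality topology.

Set Implicit Arguments.
Unset Strict Implicit.
Unset Printing Implicit Defensive.

Local Open Scope classical_set_scope.

Record signature := Signature {
  symbol : finType;
  arity : symbol -> nat }.

(* [dom] is not a [finType]: the universe of [FIN tau] would then be too large
   for [FIN tau] to carry a [choiceType] structure, hence a topology.  The
   universe of [dom] contains [Set], so every finite structure has an
   isomorphic copy in [FIN tau]; ['I_n], declared in a larger universe, is
   represented by [{i : nat | i < n}]. *)
Record FIN (tau : signature) := Structure {
  dom : Type;
  dom_finite : finite_set [set: dom];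
  dom_nonempty : [set: dom] !=set0;
  interp : forall R : symbol tau, (arity R).-tuple dom -> Prop }.

HB.instance Definition _ (tau : signature) := gen_eqMixin (FIN tau).
HB.instance Definition _ (tau : signature) := gen_choiceMixin (FIN tau).

Section Homomorphisms.
Variable tau : signature.
Implicit Types A B F : FIN tau.

Definition is_hom A B (f : dom A -> dom B) : Prop :=
  forall (R : symbol tau) (t : (arity R).-tuple (dom A)),
    interp t -> interp (map_tuple f t).

Definition hom A B : Prop := exists f : dom A -> dom B, is_hom f.

Definition isomorphic A B : Prop :=
  exists2 f : dom A -> dom B, bijective f &
    forall (R : symbol tau) (t : (arity R).-tuple (dom A)),
      interp t <-> interp (map_tuple f t).

Definition iso_closed (C : set (FIN tau)) : Prop :=
  forall A B, isomorphic A B -> C A -> C B.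

Definition homB F A : bool := `[< hom F A >].

Definition upset A : set (FIN tau) := [set B | hom A B].

Definition subbase : set (set (FIN tau)) :=
  [set U | exists A, U = upset A \/ U = ~` upset A].

End Homomorphisms.

HB.instance Definition _ (tau : signature) :=
  isSubBaseTopological.Build (FIN tau) (@subbase tau) id.

Section Algorithms.
Variable tau : signature.

Inductive label := Query of FIN tau | YES | NO.

Definition is_answer (l : label) : Prop := l = YES \/ l = NO.

Definition leaf (T : set (seq bool)) (s : seq bool) : Prop :=
  T s /\ forall t, T t -> prefix s t -> t = s.

(* [alg_fun] stands for a function with domain [alg_tree]: its values outside
   the tree are irrelevant. *)
Record algorithm := Algorithm {
  alg_tree : set (seq bool);
  alg_fun : seq bool -> label;
  alg_treeP : forall s t, prefix s t -> alg_tree t -> alg_tree s;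
  alg_leafP : forall s, alg_tree s ->
    (is_answer (alg_fun s) <-> leaf alg_tree s) }.

Definition step (G : algorithm) (A : FIN tau) (s : seq bool) : seq bool :=
  if alg_fun G s is Query F then rcons s (homB F A) else s.

Definition run (G : algorithm) (A : FIN tau) (i : nat) : seq bool :=
  iter i (step G A) [::].

(* The computation path of [G] on [A] is finite, stays in the tree and has
   limit [s]. *)
Definition computation_path (G : algorithm) (A : FIN tau) (s : seq bool) :
    Prop :=
  (forall i, alg_tree G (run G A i)) /\
  exists n, forall m, n <= m -> run G A m = s.

Definition total_algorithm (G : algorithm) : Prop :=
  forall A, exists s, computation_path G A s.

Definition decided_class (G : algorithm) : set (FIN tau) :=
  [set A | exists2 s, computation_path G A s & alg_fun G s = YES].

End Algorithms.

(* Main.v *)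
(** Up to isomorphism there are only countably many finite structures
    [F_0, F_1, ...].  A run of an algorithm asks finitely many queries, so its
    outcome is shared by a whole basic neighbourhood of the input: decided
    classes are clopen.  Conversely, for clopen [C], ask [F_0, F_1, ...] in turn
    until the inputs compatible with the answers all lie in [C] or all lie
    outside [C].  Every input has a basic neighbourhood inside [C] or inside its
    complement, and finitely many of the [F_i] cut out such a neighbourhood, so
    the run stops. *)

Require Import Defs.
From mathcomp Require Import all_boot.
From mathcomp Require Import boolp classical_sets topology.
From mathcomp Require Import cardinality finmap.

Set Implicit Arguments.
Unset Strict Implicit.
Unset Printing Implicit Defensive.

Local Open Scope classical_set_scope.

(** * Countable enumeration of finite structures up to homomorphic equivalence *)

Section Enumeration.
Variable tau : signature.
Implicit Types A B D F : FIN tau.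

Lemma hom_trans A B D : hom A B -> hom B D -> hom A D.
Proof.
move=> [f fP] [g gP]; exists (g \o f) => R t /fP /gP.
suff -> : map_tuple g (map_tuple f t) = map_tuple (g \o f) t by [].
by apply/val_inj; rewrite /= -map_comp.
Qed.

Lemma homB_hom_equiv A B D : hom A B -> hom B A -> homB A D = homB B D.
Proof.
move=> AB BA; apply/asboolP/asboolP; first exact: hom_trans.
exact: hom_trans.
Qed.

(** A code is a size [n.+1], hence a non-empty universe, with the set of all facts that hold on it;
    being a [countType], it can be enumerated. *)
Definition code : countType :=
  {n : nat & {set {R : symbol tau & (arity R).-tuple 'I_n.+1}}}.

Section Decode.
Variable n : nat.

Definition cdom : Type := {i : nat | i < n.+1}.

Definition ord_of_cdom (x : cdom) : 'I_n.+1 := Ordinal (proj2_sig x).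

Definition cdom_of_ord (i : 'I_n.+1) : cdom := exist _ (i : nat) (ltn_ord i).

Lemma cdom_of_ordK : cancel cdom_of_ord ord_of_cdom.
Proof. by move=> i; apply: val_inj. Qed.

Lemma ord_of_cdomK : cancel ord_of_cdom cdom_of_ord.
Proof. by case=> i ?; congr exist; apply: bool_irrelevance. Qed.

Lemma cdom_finite : finite_set [set: cdom].
Proof.
apply: (@sub_finite_set _ _ (cdom_of_ord @` [set: 'I_n.+1])).
  by move=> x _; exists (ord_of_cdom x) => //; rewrite ord_of_cdomK.
exact/finite_image/finite_finset.
Qed.

Lemma cdom_nonempty : [set: cdom] !=set0.
Proof. by exists (cdom_of_ord ord0). Qed.

Definition decode_structure
    (S : {set {R : symbol tau & (arity R).-tuple 'I_n.+1}}) : FIN tau :=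
  @Structure tau cdom cdom_finite cdom_nonempty
    (fun R t => Tagged _ (map_tuple ord_of_cdom t) \in S).

End Decode.

Definition decode (c : code) : FIN tau := decode_structure (tagged c).

Lemma FIN_ord A : exists n (h : dom A -> 'I_n.+1) (g : 'I_n.+1 -> dom A),
  cancel h g.
Proof.
have [n /card_set_bijP[f [fn finj fsurj]]] := dom_finite A.
have [a _] := dom_nonempty A.
case: n => [|n] in fn fsurj *; first by have := fn a I.
have /choice[g gP] : forall i : 'I_n.+1, exists x, f x = i.
  by move=> i; have [x _ <-] := fsurj i (ltn_ord i); exists x.
exists n, (fun x => Ordinal (fn x I : f x < n.+1)), g => x.
by apply: (finj _ _ (mem_set I) (mem_set I)); rewrite gP.
Qed.

(** Homomorphic equivalence is enough for the enumeration, since queries see a structure only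
    through [homB]. *)
Lemma decode_hom_surj A : exists c, hom A (decode c) /\ hom (decode c) A.
Proof.
have [n [h [g hK]]] := FIN_ord A.
(* The facts are pulled back along [g]: this makes [g] a homomorphism, and [h] is one too because
   [g] undoes [h]. *)
exists (existT _ n [set x | `[< interp (map_tuple g (tagged x)) >]]%SET).
split; [exists (@cdom_of_ord n \o h) | exists (g \o @ord_of_cdom n)] => R t /=.
  move=> tR; rewrite inE; apply/asboolP => /=.
  suff -> : map_tuple g (map_tuple (@ord_of_cdom n)
      (map_tuple (@cdom_of_ord n \o h) t)) = t by [].
  apply/val_inj; rewrite /= -!map_comp -[RHS]map_id; apply: eq_map => x /=.
  by rewrite cdom_of_ordK hK.
rewrite inE => /asboolP /=.
suff -> : map_tuple g (map_tuple (@ord_of_cdom n) t) =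
  map_tuple (g \o @ord_of_cdom n) t by [].
by apply/val_inj; rewrite /= -map_comp.
Qed.

(** Numbers that code nothing are sent to the one-element structure with empty relations. *)
Definition enumFIN (k : nat) : FIN tau :=
  decode (odflt (existT _ 0 finset.set0 : code) (choice.unpickle k)).

Lemma enumFIN_homB A : exists k, homB (enumFIN k) = homB A.
Proof.
have [c [Ac cA]] := decode_hom_surj A; exists (choice.pickle c).
apply/funext => B; rewrite /enumFIN choice.pickleK; exact: homB_hom_equiv.
Qed.

End Enumeration.

(** * Basic neighbourhoods and clopen sets *)

Section Topology.
Variable tau : signature.
Implicit Types (A B F : FIN tau) (s : seq (FIN tau)) (U : set (FIN tau)).

(** These are the basic neighbourhoods of [A]: for each [F] in [s], intersect whichever of [upset F]
    and its complement contains [A]. *)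
Definition agree s A : set (FIN tau) :=
  [set B | forall F, F \in s -> homB F B = homB F A].

Lemma agreexx s A : agree s A A.
Proof. by []. Qed.

Lemma subbase_open U : subbase U -> open U.
Proof.
move=> subU; exists [set U]; last by rewrite bigcup_set1.
move=> _ ->; exists [fset U]%fset; first by move=> V /fset1P ->; exact: mem_set.
by rewrite set_fset1 bigcap_set1.
Qed.

Lemma open_homB F b : open [set B | homB F B = b].
Proof.
apply: subbase_open; exists F.
case: b; [left | right]; apply/seteqP; split=> B /=.
- by move/asboolP.
- by move=> FB; apply/asboolP.
- by move/negbT/asboolPn.
- by move=> FB; apply/negbTE/asboolPn.
Qed.

Lemma open_agree s A : open (agree s A).
Proof.
elim: s => [|F s IHs].
  suff -> : agree [::] A = setT by exact: openT.
  by apply/seteqP; split.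
suff -> : agree (F :: s) A = [set B | homB F B = homB F A] `&` agree s A.
  by apply: openI => //; exact: open_homB.
apply/seteqP; split=> B.
  move=> AB; split=> [|D Ds]; apply: AB; first exact: mem_head.
  by rewrite inE Ds orbT.
by move=> [FB AB] D; rewrite inE => /predU1P[->//|]; exact: AB.
Qed.

Lemma openP U : open U <-> forall A, U A -> exists s, agree s A `<=` U.
Proof.
split=> [[X Xfin <-] A [V XV VA]|UP]; last first.
  rewrite openE => A /UP[s sU]; rewrite /interior/= nbhsE.
  by exists (agree s A) => //; split; [exact: open_agree | exact: agreexx].
have [W Wsub WV] := Xfin _ XV.
have [s sP] : exists s, forall Y, Y \in enum_fset W -> agree s A `<=` Y.
  have : forall Y, Y \in enum_fset W -> subbase Y /\ Y A.
    move=> Y YW; split; first exact/set_mem/Wsub.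
    by move: VA; rewrite -WV; apply.
  elim: (enum_fset W) => [|Y r IHr] rP; first by exists [::].
  have [|s sP] := IHr.
    by move=> Z Zr; apply: rP; rewrite inE Zr orbT.
  have [[F FY] YA] := rP Y (mem_head _ _).
  (* [Y] is [upset F] or its complement, so the answer to the single query [F] decides membership in
     [Y]. *)
  exists (F :: s) => Z; rewrite inE => /predU1P[-> {Z}|Zr]; last first.
    by move=> B AB; apply: (sP Z Zr) => D Ds; apply: AB; rewrite inE Ds orbT.
  move=> B /(_ F (mem_head _ _)) FAB.
  case: FY YA => ->.
    by move=> /asboolP FA; apply/asboolP; rewrite -/(homB F B) FAB.
  by move=> /asboolPn FA; apply/asboolPn; rewrite -/(homB F B) FAB.
exists s => B AB; exists V => //.
suff : V B by [].
by rewrite -WV => Y YW; exact: sP YW _ AB.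
Qed.

Lemma clopenP U :
  clopen U <-> forall A, exists s, agree s A `<=` U \/ agree s A `<=` ~` U.
Proof.
split=> [[/openP oU /closed_openC /openP cU] A|UP].
  have [UA|nUA] := pselect (U A).
    by have [s sU] := oU A UA; exists s; left.
  by have [s sU] := cU A nUA; exists s; right.
split; last rewrite -openC; apply/openP => A UA.
  have [s [sU|sU]] := UP A; exists s => //.
  by have := sU A (@agreexx _ _).
have [s [sU|sU]] := UP A; exists s => //.
by have := sU A (@agreexx _ _).
Qed.

End Topology.

(** * Decided classes are clopen *)

Section Runs.
Variables (tau : signature) (G : algorithm tau).
Implicit Types (A B F : FIN tau) (s : seq bool).

Lemma runS A i : run G A i.+1 = step G A (run G A i).
Proof. by []. Qed.

(** [qs] collects the queries asked on [A] in the first [i] steps; an input giving the same answers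
    follows the same run. *)
Lemma run_agree A i :
  exists qs, forall B, agree qs A B -> run G B i = run G A i.
Proof.
elim: i => [|i [qs qsP]]; first by exists [::].
case E : (alg_fun G (run G A i)) => [F||].
- exists (F :: qs) => B AB; rewrite !runS qsP.
    by rewrite /step E AB// mem_head.
  by move=> D Dqs; apply: AB; rewrite inE Dqs orbT.
- by exists qs => B /qsP; rewrite !runS => ->; rewrite /step E.
- by exists qs => B /qsP; rewrite !runS => ->; rewrite /step E.
Qed.

Lemma computation_path_unique A s t :
  computation_path G A s -> computation_path G A t -> s = t.
Proof.
move=> [_ [m sP]] [_ [n tP]].
by rewrite -(sP (maxn m n)) ?leq_maxl// tP// leq_maxr.
Qed.

(** The limit is fixed by [step], whereas a query would lengthen the string. *)
Lemma computation_path_answer A s :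
  computation_path G A s -> is_answer (alg_fun G s).
Proof.
move=> [_ [n nP]]; have := nP n.+1 (leqnSn n).
rewrite runS nP// /step; case: (alg_fun G s) => [F| |]; [|by left|by right].
by move=> /(congr1 size)/eqP; rewrite size_rcons eqn_leq ltnn.
Qed.

Lemma run_answer A n s : run G A n = s -> is_answer (alg_fun G s) ->
  forall m, n <= m -> run G A m = s.
Proof.
move=> ns sans; elim=> [|m IHm]; first by rewrite leqn0 => /eqP <-.
rewrite leq_eqVlt => /predU1P[<-//|/IHm mE].
by rewrite runS mE /step; case: sans => ->.
Qed.

Lemma total_path_agree A s : total_algorithm G -> computation_path G A s ->
  exists qs, forall B, agree qs A B -> computation_path G B s.
Proof.
move=> Gtot As; have sans := computation_path_answer As.
case: (As) => _ [n nP]; have [qs qsP] := run_agree A n; exists qs => B AB.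
(* Totality is used on [B] to know that its run stays in the tree. *)
have [t [Bt _]] := Gtot B; split=> //; exists n.
by apply: run_answer => //; rewrite qsP// nP.
Qed.

Lemma decided_class_clopen :
  total_algorithm G -> clopen (decided_class G).
Proof.
move=> Gtot; apply/clopenP => A; have [s As] := Gtot A.
have [qs qsP] := total_path_agree Gtot As; exists qs.
case: (computation_path_answer As) => sE; [left | right] => B /qsP Bs.
  by exists s.
by move=> [t /(computation_path_unique Bs) <-]; rewrite sE.
Qed.

End Runs.

(** * Algorithms from arbitrary labellings of binary strings *)

Section FunctionAlgorithm.
Variables (tau : signature) (f : seq bool -> label tau).
Implicit Types s t : seq bool.

(** The full binary tree is cut off below the first answer on each branch, so that the leaves are
    exactly the answers. *)
Definition fun_tree : set (seq bool) :=
  [set s | forall t, prefix t s -> size t < size s -> ~ is_answer (f t)].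

Lemma fun_tree_prefix s t : prefix s t -> fun_tree t -> fun_tree s.
Proof.
move=> st tP u us ltus; apply: tP; first exact: prefix_trans us st.
exact: leq_trans ltus (size_prefix st).
Qed.

Lemma fun_tree_rcons s b :
  fun_tree s -> ~ is_answer (f s) -> fun_tree (rcons s b).
Proof.
move=> sP fs t /prefixP[u]; case/lastP: u => [|u c].
  by rewrite cats0 => <-; rewrite ltnn.
rewrite -rcons_cat => /rcons_inj[sE _] _.
have ts : prefix t s by rewrite sE prefix_prefix.
(* Either [t] is a proper prefix of [s], covered by [fun_tree s], or [t] is [s] itself, which is not
   an answer. *)
have := size_prefix ts; rewrite leq_eqVlt => /predU1P[tsz|]; last exact: sP.
move: fs; rewrite sE; suff -> : u = [::] by rewrite cats0.
apply/eqP; rewrite -size_eq0 -(eqn_add2l (size t)) addn0 -size_cat -sE.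
by rewrite tsz.
Qed.

Lemma fun_tree_leaf s :
  fun_tree s -> (is_answer (f s) <-> leaf fun_tree s).
Proof.
move=> sT; split=> [fs|[_ sleaf]].
  split=> // t tT st; have /prefixP[u tE] := st.
  have [ltst|] := ltnP (size s) (size t); first by case: (tT s st ltst).
  rewrite tE size_cat -[leqRHS]addn0 leq_add2l leqn0 size_eq0 => /eqP ->.
  by rewrite cats0.
apply: contrapT => fs.
have sbT : fun_tree (rcons s true) by exact: fun_tree_rcons.
have /(congr1 size)/eqP := sleaf _ sbT (prefix_rcons s true).
by rewrite size_rcons eqn_leq ltnn.
Qed.

Definition fun_algorithm : algorithm tau :=
  Algorithm fun_tree_prefix fun_tree_leaf.

Lemma fun_algorithm_run_tree A i : fun_tree (run fun_algorithm A i).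
Proof.
elim: i => [//|i IHi]; rewrite runS /step /=.
case E : (f _) => [F| |] //; apply: fun_tree_rcons => //.
by rewrite E => -[].
Qed.

Lemma fun_algorithm_total :
  (forall A, exists i, is_answer (f (run fun_algorithm A i))) ->
  total_algorithm fun_algorithm.
Proof.
move=> fP A; have [i fi] := fP A; exists (run fun_algorithm A i).
by split; [exact: fun_algorithm_run_tree | exists i; exact: run_answer].
Qed.

End FunctionAlgorithm.

(** * Clopen classes are decided *)

Section ClopenDecided.
Variables (tau : signature) (C : set (FIN tau)).
Implicit Types (A B F : FIN tau) (s : seq bool).

(** The inputs compatible with the answers [s] to the first [size s] structures of the enumeration;
    the default [false] is never read. *)
Definition cell s : set (FIN tau) :=
  [set B | forall i, i < size s -> homB (enumFIN tau i) B = nth false s i].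

(** The length of [s] is the index of the next query. An empty cell passes both tests and yields
    [YES], but no run reaches it, as its input lies in the cell. *)
Definition clopen_fun s : label tau :=
  if `[< cell s `<=` C >] then YES tau
  else if `[< cell s `<=` ~` C >] then NO tau
  else Query (enumFIN tau (size s)).

Definition clopen_algorithm : algorithm tau := fun_algorithm clopen_fun.

Lemma clopen_algorithm_run_cell A i : cell (run clopen_algorithm A i) A.
Proof.
elim: i => [//|i]; rewrite runS /step /= /clopen_fun.
case: ifP => // _; case: ifP => // _; set s := run _ _ _ => IHs j.
rewrite size_rcons ltnS nth_rcons leq_eqVlt => /predU1P[->|js].
  by rewrite ltnn eqxx.
by rewrite js IHs.
Qed.

(** Until an answer is reached, each step adds one bit, so [i] steps ask the first [i] queries. *)
Lemma clopen_algorithm_run_size A i :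
  is_answer (clopen_fun (run clopen_algorithm A i)) \/
  size (run clopen_algorithm A i) = i.
Proof.
elim: i => [|i [fs|IHi]]; first by right.
  by left; rewrite (run_answer (erefl (run clopen_algorithm A i))).
rewrite runS /step /=.
case E : (clopen_fun (run clopen_algorithm A i)) => [F| |].
- by right; rewrite size_rcons IHi.
- by left; rewrite E; left.
- by left; rewrite E; right.
Qed.

Lemma enumFIN_agree (qs : seq (FIN tau)) : exists N, forall A s,
  N <= size s -> cell s A -> cell s `<=` agree qs A.
Proof.
elim: qs => [|F qs [N NP]]; first by exists 0.
(* A string of length at least [k.+1] records the answer to query [k], which stands for [F]. *)
have [k kF] := enumFIN_homB F; exists (maxn k.+1 N) => A s.
rewrite geq_max => /andP[ks Ns] As B Bs D; rewrite inE => /predU1P[->|Dqs].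
  by rewrite -kF As// Bs.
exact: (NP A s).
Qed.

Hypothesis clC : clopen C.

Lemma clopen_algorithm_total : total_algorithm clopen_algorithm.
Proof.
apply: fun_algorithm_total => A.
have /clopenP/(_ A)[qs qsC] := clC; have [N NP] := enumFIN_agree qs.
exists N; have [//|szN] := clopen_algorithm_run_size A N.
set s := run _ _ _ in szN *.
have sA : cell s `<=` agree qs A.
  by apply: NP; [rewrite szN | exact: clopen_algorithm_run_cell].
(* After [N] queries the cell lies in a neighbourhood of [A] inside [C] or inside its complement, so
   one of the two tests succeeds. *)
rewrite /clopen_fun; case: asboolP => [_|nC]; first by left.
case: asboolP => [_|nCC]; first by right.
by case: qsC => qsC; [case: nC | case: nCC]; exact: subset_trans sA qsC.
Qed.

(** Each input lies in the cell of its own path, and an answer is given only when it is correct for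
    the whole cell. *)
Lemma clopen_algorithm_decides : decided_class clopen_algorithm = C.
Proof.
have path_cell A s : computation_path clopen_algorithm A s -> cell s A.
  by move=> [_ [n /(_ n (leqnn n)) <-]]; exact: clopen_algorithm_run_cell.
apply/seteqP; split=> A.
  move=> [s /path_cell As] /=; rewrite /clopen_fun.
  by case: asboolP => [sC _|_]; [exact: sC | case: ifP].
move=> CA; have [s As] := clopen_algorithm_total A; exists s => //.
case: (computation_path_answer As) => //=; rewrite /clopen_fun.
case: ifP => // _; case: asboolP => // sC _.
by case: (sC A (path_cell _ _ As)).
Qed.

End ClopenDecided.

Theorem theorem22 (tau : signature) (C : set (FIN tau)) (hC : iso_closed C) :
  (exists2 G : algorithm tau, total_algorithm G & decided_class G = C) <-> clopen C.
Proof.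
split=> [[G Gtot <-]|clC]; first exact: decided_class_clopen.
exists (clopen_algorithm C); first exact: clopen_algorithm_total.
exact: clopen_algorithm_decides.
Qed.
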